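(* Let $(\Phi,\phi,\widetilde\phi):(\mathcal C,p,pt)\to(\mathcal C',p',pt')$ be a functor of universe categories. Then the recursive definition of $(H_n,\psi_n)$ given in the context is meaningful (at each stage the morphism $\psi_{n+1}(A,F)$ with the stated properties exists, is unique and is an isomorphism), and the pair of functions $$H_{Ob}(n,A)=(n,H_n(A)),\qquad H_{Mor}(\Gamma,(\Gamma',a))=(H_{Ob}(\Gamma),(H_{Ob}(\Gamma'),H(a)))$$ is a homomorphism of C-systems $H=H(\Phi,\phi,\widetilde\phi):CC(\mathcal C,p)\to CC(\mathcal C',p')$.
   Context: Composition of morphisms is written in diagrammatic order: $f\circ g$ means first $f$, then $g$. **Universe categories.** A universe structure on a morphism $p:\widetilde U\to U$ of a category $\mathcal C$ assigns to every morphism $F:X\to U$ a pull-back square (the canonical square of $F$) with vertex $(X;F)$ and projections $p_{X,F}:(X;F)\to X$, $Q(F):(X;F)\to\widetilde U$ (so $p_{X,F}\circ F=Q(F)\circ p$). For $f:W\to X$, $g:W\to\widetilde U$ with $f\circ F=g\circ p$, $f*g:W\to (X;F)$ is the unique morphism with $(f*g)\circ p_{X,F}=f$ and $(f*g)\circ Q(F)=g$. For $f:X'\to X$ and $F:X\to U$ put $Q(f,F)=(p_{X',f\circ F}\circ f)*Q(f\circ F):(X';f\circ F)\to(X;F)$. A universe category is a triple $(\mathcal C,p,pt)$ where $p$ is a morphism of $\mathcal C$ equipped with a universe structure and $pt$ is a (chosen) final object of $\mathcal C$. **C-systems.** A C0-system is a (small) category $CC$ with a function $l:Ob(CC)\to\mathbb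 N$, an object $pt$, a function $ft:Ob(CC)\to Ob(CC)$, for each $X$ a morphism $p_X:X\to ft(X)$, and for each $X$ with $l(X)>0$ and each $f:Y\to ft(X)$ an object $f^*(X)$ and a morphism $q(f,X):f^*(X)\to X$, such that: (1) $l^{-1}(0)=\{pt\}$; (2) $l(ft(X))=l(X)-1$ if $l(X)>0$; (3) $ft(pt)=pt$; (4) $pt$ is final; (5) if $l(X)>0$ and $f:Y\to ft(X)$ then $l(f^*(X))>0$, $ft(f^*(X))=Y$ and $p_{f^*(X)}\circ f=q(f,X)\circ p_X$; (6) if $l(X)>0$ then $Id_{ft(X)}^*(X)=X$ and $q(Id_{ft(X)},X)=Id_X$; (7) if $l(X)>0$, $f:Y\to ft(X)$, $g:Z\to Y$, then $(g\circ f)^*(X)=g^*(f^*(X))$ and $q(g\circ f,X)=q(g,f^*(X))\circ q(f,X)$. A C-system is a C0-system with an operation assigning to each $f:Y\to X$ with $l(X)>0$ a morphism $s_f:Y\to (f\circ p_X)^*(X)$ such that $s_f\circ p_{(f\circ p_X)^*(X)}=Id_Y$, $f=s_f\circ q(f\circ p_X,X)$, and, whenever $X=g^*(Z)$ with $l(Z)>0$ and $g:ft(X)\to ft(Z)$, $s_f=s_{f\circ q(g,Z)}$. A homomorphism of C-systems is a functor $F$ between the underlying categories (functions on $Ob$ and $Mor$) commuting with $l$ and $ft$ and such that $F(p_X)=p_{F(X)}$ for all $X$, $F(q(f,Y))=q(F(f),F(Y))$ for $l(Y)>0$, $f:X\to ft(Y)$, and $F(s_f)=s_{F(f)}$ for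 $f:X\to Y$, $l(Y)>0$. **The C-system $CC(\mathcal C,p)$.** Define by induction sets $Ob_n=Ob_n(\mathcal C,p)$ and functions $int:Ob_n\to Ob(\mathcal C)$: $Ob_0=\{tt\}$, $int(tt)=pt$; $Ob_{n+1}=\coprod_{A\in Ob_n}Hom_{\mathcal C}(int(A),U)$, $int(A,F)=(int(A);F)$. Then $CC(\mathcal C,p)$ has objects the pairs $(n,A)$, $A\in Ob_n$, with $int(n,A)=int(A)$; morphisms $\Gamma\to\Gamma'$ are the elements $(\Gamma,(\Gamma',a))$ with $a\in Hom_{\mathcal C}(int(\Gamma),int(\Gamma'))$, and $int$ of such a morphism is $a$; identities and composition are those of $\mathcal C$; $l(n,A)=n$; $pt=(0,tt)$; $ft(n+1,(B,F))=(n,B)$, $ft(0,tt)=(0,tt)$; $int(p_{(n+1,(B,F))})=p_{int(B),F}$, $p_{(0,tt)}=Id$; for $\Delta=(n+1,(B,F))$ and $f:(m,A)\to(n,B)$, $f^*(\Delta)=(m+1,(A,int(f)\circ F))$ and $int(q(f,\Delta))=Q(int(f),F)$; the $s$-operation is the unique one making this a C-system. **Functors of universe categories.** A functor of universe categories $(\mathcal C,p,pt)\to(\mathcal C',p',pt')$ is a triple $(\Phi,\phi,\widetilde\phi)$ of a functor $\Phi:\mathcal C\to\mathcal C'$ and morphisms $\phi:\Phi(U)\to U'$, $\widetilde\phi:\Phi(\widetilde U)\to\widetilde U'$ such that $\Phi$ takes the canonical pull-back squares based on $p$ to pull-back squares, $\Phi(pt)$ is final in $\mathcal C'$, and the square with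 sides $\widetilde\phi$, $\Phi(p)$, $p'$, $\phi$ (i.e. $\widetilde\phi\circ p'=\Phi(p)\circ\phi$) is a pull-back square. **Recursive definition.** Let $Ob_n=Ob_n(\mathcal C,p)$, $Ob'_n=Ob_n(\mathcal C',p')$, with functions $int$, $int'$. Define functions $H_n:Ob_n\to Ob'_n$ and families of isomorphisms $\psi_n(A):int'(H_n(A))\to\Phi(int(A))$, $A\in Ob_n$: $H_0$ is the unique map and $\psi_0(tt):pt'\to\Phi(pt)$ the unique isomorphism; $H_{n+1}(A,F)=(H_n(A),\psi_n(A)\circ\Phi(F)\circ\phi)$ and $\psi_{n+1}(A,F):int'(H_{n+1}(A,F))\to\Phi(int(A,F))$ is the unique morphism such that $\psi_{n+1}(A,F)\circ\Phi(p_{int(A),F})=p_{int'(H_n(A)),\psi_n(A)\circ\Phi(F)\circ\phi}\circ\psi_n(A)$ and $\psi_{n+1}(A,F)\circ\Phi(Q(F))\circ\widetilde\phi=Q(\psi_n(A)\circ\Phi(F)\circ\phi)$. For $A\in Ob_m$, $A'\in Ob_{m'}$ and $a:int(A)\to int(A')$ put $H(a)=\psi_m(A)\circ\Phi(a)\circ\psi_{m'}(A')^{-1}:int'(H_m(A))\to int'(H_{m'}(A'))$. *)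

(* Defs.v *)
From Stdlib Require Import ClassicalEpsilon.
From mathcomp Require Import all_boot.

Set Implicit Arguments.
Unset Strict Implicit.
Unset Printing Implicit Defensive.

(** * Categories *)

Reserved Notation "f ;; g" (at level 40, left associativity).

(* Composition is in diagrammatic order: [f ;; g] is first [f], then [g]. *)
Record Category : Type := MkCategory {
  Ob :> Type;
  Hom : Ob -> Ob -> Type;
  idm : forall X : Ob, Hom X X;
  comp : forall X Y Z : Ob, Hom X Y -> Hom Y Z -> Hom X Z;
  comp_id_l : forall (X Y : Ob) (f : Hom X Y), comp (idm X) f = f;
  comp_id_r : forall (X Y : Ob) (f : Hom X Y), comp f (idm Y) = f;
  comp_assoc : forall (X Y Z W : Ob) (f : Hom X Y) (g : Hom Y Z) (h : Hom Z W),
    comp (comp f g) h = comp f (comp g h)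
}.

Arguments Hom {_} _ _.
Arguments idm {_} _.
Arguments comp {_ _ _ _} _ _.

Notation "f ;; g" := (comp f g).

(* The set of all morphisms.  Equality of morphisms whose sources or targets
   are not convertible is stated in it: [mor f = mor g] says that [f] and [g]
   have the same source, the same target, and are equal. *)
Definition Mor (C : Category) : Type := {X : C & {Y : C & Hom X Y}}.

Definition mor (C : Category) (X Y : C) (f : Hom X Y) : Mor C :=
  existT _ X (existT _ Y f).

(* [f] regarded as a morphism to an object equal to its target. *)
Definition recod (C : Category) (X Y Y' : C) (e : Y = Y') (f : Hom X Y) :
  Hom X Y' := eq_rect Y (fun Z => Hom X Z) f Y' e.

Definition is_final (C : Category) (T : C) : Prop :=
  forall X : C, exists f : Hom X T, forall g : Hom X T, g = f.

(* The square
<<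
      P --q--> Y
      |        |
      p        g
      v        v
      X --f--> Z
>>
   commutes and is cartesian. *)
Definition is_pullback (C : Category) (P X Y Z : C)
    (p : Hom P X) (q : Hom P Y) (f : Hom X Z) (g : Hom Y Z) : Prop :=
  p ;; f = q ;; g /\
  forall (W : C) (u : Hom W X) (v : Hom W Y), u ;; f = v ;; g ->
    exists! h : Hom W P, h ;; p = u /\ h ;; q = v.

Record Iso (C : Category) (X Y : C) : Type := MkIso {
  iso_mor :> Hom X Y;
  iso_inv : Hom Y X;
  iso_mor_inv : iso_mor ;; iso_inv = idm X;
  iso_inv_mor : iso_inv ;; iso_mor = idm Y
}.

Record is_functor (C D : Category) (Fob : C -> D)
    (Fhom : forall X Y : C, Hom X Y -> Hom (Fob X) (Fob Y)) : Prop :=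
  MkIsFunctor {
  functor_id : forall X : C, Fhom X X (idm X) = idm (Fob X);
  functor_comp : forall (X Y Z : C) (f : Hom X Y) (g : Hom Y Z),
    Fhom X Z (f ;; g) = Fhom X Y f ;; Fhom Y Z g
}.

Record Functor (C D : Category) : Type := MkFunctor {
  fob :> C -> D;
  fmap : forall X Y : C, Hom X Y -> Hom (fob X) (fob Y);
  functorP : is_functor fmap
}.

Arguments fmap {_ _} _ {_ _} _.

(** * Universe categories *)

Record UniverseStructure (C : Category) (Ut U : C) (p : Hom Ut U) : Type :=
  MkUniverseStructure {
  us_ob : forall X : C, Hom X U -> C;
  us_pr : forall (X : C) (F : Hom X U), Hom (us_ob F) X;
  us_Q : forall (X : C) (F : Hom X U), Hom (us_ob F) Ut;
  us_pullback : forall (X : C) (F : Hom X U),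
    is_pullback (us_pr F) (us_Q F) F p
}.

Record UniverseCategory : Type := MkUniverseCategory {
  uc_cat :> Category;
  Ut : uc_cat;
  U : uc_cat;
  univ : Hom Ut U;
  uc_str : UniverseStructure univ;
  pt : uc_cat;
  pt_final : is_final pt
}.

Arguments Ut {_}.
Arguments U {_}.
Arguments univ {_}.
Arguments pt {_}.

Section UniverseCategoryOps.

Variable C : UniverseCategory.
Implicit Types W X : C.

(* The canonical square of [F]: its vertex [(X;F)] and its projections
   [p_{X,F}] and [Q(F)]. *)
Definition pb X (F : Hom X U) : C := us_ob (uc_str C) F.
Definition pr X (F : Hom X U) : Hom (pb F) X := us_pr (uc_str C) F.
Definition Q X (F : Hom X U) : Hom (pb F) Ut := us_Q (uc_str C) F.

Lemma pb_pullback X (F : Hom X U) : is_pullback (pr F) (Q F) F univ.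
Proof. exact: us_pullback. Qed.

Lemma pb_comm X (F : Hom X U) : pr F ;; F = Q F ;; univ.
Proof. by case: (pb_pullback F). Qed.

(* [f * g], the unique morphism to [(X;F)] with the given components. *)
Definition pair W X (F : Hom X U) (f : Hom W X) (g : Hom W Ut)
    (e : f ;; F = g ;; univ) : Hom W (pb F) :=
  proj1_sig (constructive_definite_description _
    (proj2 (pb_pullback F) W f g e)).

Lemma pair_pr W X (F : Hom X U) (f : Hom W X) (g : Hom W Ut)
  (e : f ;; F = g ;; univ) : pair e ;; pr F = f.
Proof.
by rewrite /pair; case: constructive_definite_description => h /= [].
Qed.

Lemma pair_Q W X (F : Hom X U) (f : Hom W X) (g : Hom W Ut)
  (e : f ;; F = g ;; univ) : pair e ;; Q F = g.
Proof.
by rewrite /pair; case: constructive_definite_description => h /= [].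
Qed.

Lemma pb_ext W X (F : Hom X U) (h k : Hom W (pb F)) :
  h ;; pr F = k ;; pr F -> h ;; Q F = k ;; Q F -> h = k.
Proof.
move=> e1 e2; case: (pb_pullback F) => e /(_ _ (h ;; pr F) (h ;; Q F)).
rewrite !comp_assoc e => /(_ erefl) [x [_ ux]].
by rewrite -(ux h) // -(ux k).
Qed.

Lemma Q2_comm X' X (f : Hom X' X) (F : Hom X U) :
  (pr (f ;; F) ;; f) ;; F = Q (f ;; F) ;; univ.
Proof. by rewrite comp_assoc pb_comm. Qed.

(* The morphism [Q(f,F)]. *)
Definition Q2 X' X (f : Hom X' X) (F : Hom X U) : Hom (pb (f ;; F)) (pb F) :=
  pair (Q2_comm f F).

Lemma Q2_pr X' X (f : Hom X' X) (F : Hom X U) :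
  Q2 f F ;; pr F = pr (f ;; F) ;; f.
Proof. exact: pair_pr. Qed.

Lemma Q2_Q X' X (f : Hom X' X) (F : Hom X U) : Q2 f F ;; Q F = Q (f ;; F).
Proof. exact: pair_Q. Qed.

End UniverseCategoryOps.

(** * C-systems *)

(* In [c0_q_comp] the morphism [g : Z -> Y] has to be read as a morphism to
   [ft (f^*(X))], and in [c0_square] the morphism [p_{f^*(X)}] as a morphism
   to [Y]; both use the equality [c0_ft_star]. *)
Record C0System : Type := MkC0System {
  c0_cat :> Category;
  len : c0_cat -> nat;
  c0_pt : c0_cat;
  ft : c0_cat -> c0_cat;
  c0_p : forall X : c0_cat, Hom X (ft X);
  star : forall X : c0_cat, 0 < len X ->
    forall Y : c0_cat, Hom Y (ft X) -> c0_cat;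
  c0_q : forall (X : c0_cat) (hX : 0 < len X) (Y : c0_cat)
    (f : Hom Y (ft X)), Hom (star hX f) X;
  c0_len0 : forall X : c0_cat, len X = 0 <-> X = c0_pt;
  c0_len_ft : forall X : c0_cat, 0 < len X -> len (ft X) = len X - 1;
  c0_ft_pt : ft c0_pt = c0_pt;
  c0_pt_final : is_final c0_pt;
  c0_len_star : forall (X : c0_cat) (hX : 0 < len X) (Y : c0_cat)
    (f : Hom Y (ft X)), 0 < len (star hX f);
  c0_ft_star : forall (X : c0_cat) (hX : 0 < len X) (Y : c0_cat)
    (f : Hom Y (ft X)), ft (star hX f) = Y;
  c0_square : forall (X : c0_cat) (hX : 0 < len X) (Y : c0_cat)
    (f : Hom Y (ft X)),
    recod (c0_ft_star hX f) (c0_p (star hX f)) ;; f = c0_q hX f ;; c0_p X;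
  c0_star_id : forall (X : c0_cat) (hX : 0 < len X),
    star hX (idm (ft X)) = X;
  c0_q_id : forall (X : c0_cat) (hX : 0 < len X),
    mor (c0_q hX (idm (ft X))) = mor (idm X);
  c0_star_comp : forall (X : c0_cat) (hX : 0 < len X) (Y : c0_cat)
    (f : Hom Y (ft X)) (Z : c0_cat) (g : Hom Z Y),
    star hX (g ;; f) =
    star (c0_len_star hX f) (recod (esym (c0_ft_star hX f)) g);
  c0_q_comp : forall (X : c0_cat) (hX : 0 < len X) (Y : c0_cat)
    (f : Hom Y (ft X)) (Z : c0_cat) (g : Hom Z Y),
    mor (c0_q hX (g ;; f)) =
    mor (c0_q (c0_len_star hX f) (recod (esym (c0_ft_star hX f)) g)
         ;; c0_q hX f)
}.

Arguments len {_} _.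
Arguments ft {_} _.
Arguments c0_p {_} _.
Arguments star {_} _ _ {_} _.
Arguments c0_q {_} _ _ {_} _.
Arguments c0_len_star {_} _ _ {_} _.
Arguments c0_ft_star {_} _ _ {_} _.

(* In [s_stable] the object [X] of the axiom is [g^*(Z)], so that [V] is
   [ft X] by [c0_ft_star]. *)
Record is_s_operation (CC : C0System)
    (s : forall (X : CC) (hX : 0 < len X) (Y : CC) (f : Hom Y X),
       Hom Y (star X hX (f ;; c0_p X))) : Prop := MkIsSOperation {
  s_section : forall (X : CC) (hX : 0 < len X) (Y : CC) (f : Hom Y X),
    s X hX Y f ;; recod (c0_ft_star X hX (f ;; c0_p X))
                        (c0_p (star X hX (f ;; c0_p X))) = idm Y;
  s_factor : forall (X : CC) (hX : 0 < len X) (Y : CC) (f : Hom Y X),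
    f = s X hX Y f ;; c0_q X hX (f ;; c0_p X);
  s_stable : forall (Z : CC) (hZ : 0 < len Z) (V : CC) (g : Hom V (ft Z))
    (Y : CC) (f : Hom Y (star Z hZ g)),
    mor (s (star Z hZ g) (c0_len_star Z hZ g) Y f) =
    mor (s Z hZ Y (f ;; c0_q Z hZ g))
}.

Record CSystem : Type := MkCSystem {
  cs_c0 :> C0System;
  cs_s : forall (X : cs_c0) (hX : 0 < len X) (Y : cs_c0) (f : Hom Y X),
    Hom Y (star X hX (f ;; c0_p X));
  cs_sP : is_s_operation cs_s
}.

Arguments cs_s {_} _ _ {_} _.

Lemma eq_pos (m n : nat) : m = n -> 0 < n -> 0 < m.
Proof. by move=> ->. Qed.

(* The function on all morphisms is given by its restrictions to the sets of
   morphisms with fixed source and target. *)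
Record is_CSystem_hom (CC DD : CSystem) (Fob : CC -> DD)
    (Fhom : forall X Y : CC, Hom X Y -> Hom (Fob X) (Fob Y)) : Prop :=
  MkIsCSystemHom {
  csh_functor : is_functor Fhom;
  csh_len : forall X : CC, len (Fob X) = len X;
  csh_ft : forall X : CC, Fob (ft X) = ft (Fob X);
  csh_p : forall X : CC, mor (Fhom X (ft X) (c0_p X)) = mor (c0_p (Fob X));
  csh_q : forall (Y : CC) (hY : 0 < len Y) (X : CC) (f : Hom X (ft Y)),
    mor (Fhom (star Y hY f) Y (c0_q Y hY f)) =
    mor (c0_q (Fob Y) (eq_pos (csh_len Y) hY)
              (recod (csh_ft Y) (Fhom X (ft Y) f)));
  csh_s : forall (Y : CC) (hY : 0 < len Y) (X : CC) (f : Hom X Y),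
    mor (Fhom X (star Y hY (f ;; c0_p Y)) (cs_s Y hY f)) =
    mor (cs_s (Fob Y) (eq_pos (csh_len Y) hY) (Fhom X Y f))
}.

(** * The C-system of a universe category *)

(* The sets [Ob_n] and the functions [int] are defined by simultaneous
   recursion on [n]. *)
Fixpoint Ob_int (C : UniverseCategory) (n : nat) : {T : Type & T -> C} :=
  match n with
  | 0 => existT (fun T : Type => T -> C) unit (fun=> pt)
  | m.+1 =>
    existT (fun T : Type => T -> C)
      {A : projT1 (Ob_int C m) & Hom (projT2 (Ob_int C m) A) U}
      (fun AF => pb (projT2 AF))
  end.

Definition Obn (C : UniverseCategory) (n : nat) : Type := projT1 (Ob_int C n).

Definition int (C : UniverseCategory) (n : nat) : Obn C n -> C :=
  projT2 (Ob_int C n).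

Arguments int {C n} _.

Definition ext (C : UniverseCategory) (n : nat) (A : Obn C n)
    (F : Hom (int A) U) : Obn C n.+1 := existT _ A F.

Section CCSystem.

Variable C : UniverseCategory.

Definition cc_ob : Type := {n : nat & Obn C n}.

Definition cc_int (G : cc_ob) : C := int (projT2 G).

Definition cc_cat : Category := {|
  Ob := cc_ob;
  Hom := fun G D => Hom (cc_int G) (cc_int D);
  idm := fun G => idm (cc_int G);
  comp := fun G D E a b => a ;; b;
  comp_id_l := fun G D a => comp_id_l a;
  comp_id_r := fun G D a => comp_id_r a;
  comp_assoc := fun G D E T a b c => comp_assoc a b c
|}.

Definition cc_mk (n : nat) (A : Obn C n) : cc_cat := existT (Obn C) n A.

Definition cc_len (G : cc_cat) : nat := projT1 G.

Definition cc_pt : cc_cat := @cc_mk 0 tt.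

Definition cc_ft (G : cc_cat) : cc_cat :=
  match G with
  | existT 0 _ => cc_pt
  | existT n.+1 A => cc_mk (projT1 A)
  end.

Definition cc_p (G : cc_cat) : Hom G (cc_ft G) :=
  match G return @Hom cc_cat G (cc_ft G) with
  | existT n A =>
    match n return forall A : Obn C n, Hom (cc_mk A) (cc_ft (cc_mk A)) with
    | 0 => fun=> idm (pt : C)
    | m.+1 => fun A => pr (projT2 A)
    end A
  end.

Lemma not_pos0 (T : Type) : 0 < 0 -> T.
Proof. by []. Qed.

Definition cc_star (D : cc_cat) : 0 < cc_len D ->
    forall G : cc_cat, Hom G (cc_ft D) -> cc_cat :=
  match D with
  | existT n A =>
    match n return forall A : Obn C n, 0 < n ->
        forall G : cc_cat, Hom G (cc_ft (cc_mk A)) -> cc_cat with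
    | 0 => fun _ h _ _ => not_pos0 cc_cat h
    | m.+1 => fun A _ G f =>
      cc_mk (@ext C _ (projT2 G) ((f : Hom (cc_int G) _) ;; projT2 A))
    end A
  end.

Definition cc_q (D : cc_cat) : forall (h : 0 < cc_len D) (G : cc_cat)
    (f : Hom G (cc_ft D)), Hom (cc_star h f) D :=
  match D return forall (h : 0 < cc_len D) (G : cc_cat)
    (f : Hom G (cc_ft D)), @Hom cc_cat (cc_star h f) D with
  | existT n A =>
    match n return forall (A : Obn C n)
        (h : 0 < cc_len (cc_mk A)) (G : cc_cat)
        (f : Hom G (cc_ft (cc_mk A))), Hom (cc_star h f) (cc_mk A) with
    | 0 => fun _ h _ _ => not_pos0 _ h
    | m.+1 => fun A _ G f => Q2 (f : Hom (cc_int G) _) (projT2 A)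
    end A
  end.

Lemma cc_len0 (X : cc_cat) : cc_len X = 0 <-> X = cc_pt.
Proof. by split=> [|->//]; case: X => [[|n] A] //= _; case: A. Qed.

Lemma cc_len_ft (X : cc_cat) : 0 < cc_len X -> cc_len (cc_ft X) = cc_len X - 1.
Proof. by case: X => [[|n] A] //= _; rewrite subn1. Qed.

Lemma cc_len_star (X : cc_cat) (hX : 0 < cc_len X) (Y : cc_cat)
  (f : Hom Y (cc_ft X)) : 0 < cc_len (cc_star hX f).
Proof. by case: X hX f => [[|n] A]. Qed.

Lemma cc_ft_star (X : cc_cat) (hX : 0 < cc_len X) (Y : cc_cat)
  (f : Hom Y (cc_ft X)) : cc_ft (cc_star hX f) = Y.
Proof. by case: X hX f => [[|n] A] // hX; case: Y. Defined.

(* Morphisms to [(B;F)] that agree in both components are equal, also when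
   [F] is only known up to equality. *)
Lemma cc_mor_eq (Y : cc_cat) (n : nat) (B : Obn C n)
    (F1 F2 : Hom (int B) U) (h1 : Hom (cc_int Y) (pb F1))
    (h2 : Hom (cc_int Y) (pb F2)) :
  F1 = F2 -> h1 ;; pr F1 = h2 ;; pr F2 -> h1 ;; Q F1 = h2 ;; Q F2 ->
  mor (h1 : @Hom cc_cat Y (cc_mk (ext F1))) =
  mor (h2 : @Hom cc_cat Y (cc_mk (ext F2))).
Proof. by move=> e; subst F2 => e1 e2; rewrite (pb_ext e1 e2). Qed.

Lemma cc_mor_eq2 (m n : nat) (A : Obn C m) (B : Obn C n)
    (G1 G2 : Hom (int A) U) (F : Hom (int B) U) (k : Hom (int A) (int B))
    (h1 : Hom (pb G1) (pb F)) (h2 : Hom (pb G2) (pb F)) :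
  G1 = G2 -> h1 ;; pr F = pr G1 ;; k -> h2 ;; pr F = pr G2 ;; k ->
  h1 ;; Q F = Q G1 -> h2 ;; Q F = Q G2 ->
  mor (h1 : @Hom cc_cat (cc_mk (ext G1)) (cc_mk (ext F))) =
  mor (h2 : @Hom cc_cat (cc_mk (ext G2)) (cc_mk (ext F))).
Proof.
move=> e; subst G2 => e1 e2 e3 e4.
by rewrite (@pb_ext C _ _ _ h1 h2) ?e1 ?e2 ?e3 ?e4.
Qed.

Lemma cc_square (X : cc_cat) (hX : 0 < cc_len X) (Y : cc_cat)
  (f : Hom Y (cc_ft X)) :
  recod (cc_ft_star hX f) (cc_p (cc_star hX f)) ;; f = cc_q hX f ;; cc_p X.
Proof.
case: X hX f => [[|n] A0] // hX; case: A0 hX => B F hX; case: Y => m A f /=.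
exact/esym/Q2_pr.
Qed.

Lemma cc_star_id (X : cc_cat) (hX : 0 < cc_len X) :
  cc_star hX (idm (cc_ft X)) = X.
Proof.
by case: X hX => [[|n] A0] // hX; case: A0 hX => B F hX /=; rewrite comp_id_l.
Qed.

Lemma cc_q_id (X : cc_cat) (hX : 0 < cc_len X) :
  mor (cc_q hX (idm (cc_ft X))) = mor (idm X).
Proof.
case: X hX => [[|n] A0] // hX; case: A0 hX => B F hX.
apply: (@cc_mor_eq2 _ _ _ _ _ F F (idm (int B))); rewrite ?comp_id_l //.
- exact: Q2_pr.
- by rewrite comp_id_r.
- exact: Q2_Q.
Qed.

Lemma cc_star_comp (X : cc_cat) (hX : 0 < cc_len X) (Y : cc_cat)
  (f : Hom Y (cc_ft X)) (Z : cc_cat) (g : Hom Z Y) :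
  cc_star hX (g ;; f) =
  cc_star (cc_len_star hX f) (recod (esym (cc_ft_star hX f)) g).
Proof.
case: X hX f => [[|n] A0] // hX; case: A0 hX => B F hX; case: Y g => m A g f /=.
by rewrite comp_assoc.
Qed.

Lemma cc_q_comp (X : cc_cat) (hX : 0 < cc_len X) (Y : cc_cat)
  (f : Hom Y (cc_ft X)) (Z : cc_cat) (g : Hom Z Y) :
  mor (cc_q hX (g ;; f)) =
  mor (cc_q (cc_len_star hX f) (recod (esym (cc_ft_star hX f)) g)
       ;; cc_q hX f).
Proof.
case: X hX f => [[|n] A0] // hX; case: A0 hX => B F hX; case: Y g => m A; case: Z => k D g f.
move: (g : Hom (int D) (int A)) (f : Hom (int A) (int B)) => {}g {}f.
apply: (@cc_mor_eq2 _ _ _ _ ((g ;; f) ;; F) (g ;; (f ;; F)) F (g ;; f)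
          (Q2 (g ;; f) F) (Q2 g (f ;; F) ;; Q2 f F)).
- by rewrite comp_assoc.
- exact: Q2_pr.
- by rewrite comp_assoc Q2_pr -[LHS]comp_assoc Q2_pr comp_assoc.
- exact: Q2_Q.
- by rewrite comp_assoc !Q2_Q.
Qed.

Lemma cc_pt_final : is_final cc_pt.
Proof. by move=> X; exact: (pt_final (u := C)). Qed.

Definition cc_c0 : C0System := {|
  c0_cat := cc_cat;
  len := cc_len;
  c0_pt := cc_pt;
  ft := cc_ft;
  c0_p := cc_p;
  star := cc_star;
  c0_q := cc_q;
  c0_len0 := cc_len0;
  c0_len_ft := cc_len_ft;
  c0_ft_pt := erefl;
  c0_pt_final := cc_pt_final;
  c0_len_star := cc_len_star;
  c0_ft_star := cc_ft_star;
  c0_square := cc_square;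
  c0_star_id := cc_star_id;
  c0_q_id := cc_q_id;
  c0_star_comp := cc_star_comp;
  c0_q_comp := cc_q_comp
|}.

Lemma s_comm (W X : C) (F : Hom X U) (f : Hom W (pb F)) :
  idm W ;; ((f ;; pr F) ;; F) = (f ;; Q F) ;; univ.
Proof. by rewrite comp_id_l !comp_assoc pb_comm. Qed.

(* On [Delta = (n+1,(B,F))] and [f : Gamma -> Delta] the operation [s] is
   [Id * (f o Q(F))].  By [cc_s_unique] below there is no other choice. *)
Definition cc_s (X : cc_c0) : forall (hX : 0 < len X) (Y : cc_c0)
    (f : Hom Y X), Hom Y (star X hX (f ;; c0_p X)) :=
  match X return forall (hX : 0 < cc_len X) (Y : cc_cat)
    (f : @Hom cc_cat Y X), Hom Y (cc_star hX (f ;; cc_p X)) with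
  | existT n A =>
    match n return forall (A : Obn C n) (hX : 0 < cc_len (cc_mk A))
        (Y : cc_cat) (f : Hom Y (cc_mk A)),
        Hom Y (cc_star hX (f ;; cc_p (cc_mk A))) with
    | 0 => fun _ h _ _ => not_pos0 _ h
    | m.+1 => fun A _ Y f => pair (@s_comm (cc_int Y) _ (projT2 A) f)
    end A
  end.

Lemma cc_sP : is_s_operation cc_s.
Proof.
split.
- move=> [[|n] A0] // hX [m A] f; case: A0 hX f => B F hX f /=; exact: pair_pr.
- move=> [[|n] A0] // hX [m A] f; case: A0 hX f => B F hX f /=.
  apply: (@pb_ext C _ _ F).
  + rewrite [RHS]comp_assoc Q2_pr -[RHS]comp_assoc.
    by rewrite pair_pr comp_id_l.
  + by rewrite [RHS]comp_assoc Q2_Q pair_Q.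
- move=> [[|n] A0] // hZ [m V] g [k Y] f; case: A0 hZ g f => B F hZ g f.
  apply: cc_mor_eq => /=.
  + rewrite -!comp_assoc; congr (_ ;; _); rewrite !comp_assoc.
    by congr (_ ;; _); exact/esym/Q2_pr.
  + by rewrite !pair_pr.
  + by rewrite !pair_Q comp_assoc; congr (_ ;; _); exact/esym/Q2_Q.
Qed.

Lemma section_unique (W X : C) (F : Hom X U) (f : Hom W (pb F))
    (h k : Hom W (pb ((f ;; pr F) ;; F))) :
  h ;; pr _ = idm W -> k ;; pr _ = idm W ->
  f = h ;; Q2 (f ;; pr F) F -> f = k ;; Q2 (f ;; pr F) F -> h = k.
Proof.
move=> h1 k1 h2 k2; apply: pb_ext; first by rewrite h1 k1.
by rewrite -(Q2_Q (f ;; pr F) F) -!comp_assoc -h2 -k2.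
Qed.

Lemma cc_s_unique
    (s : forall (X : cc_c0) (hX : 0 < len X) (Y : cc_c0) (f : Hom Y X),
       Hom Y (star X hX (f ;; c0_p X))) :
  is_s_operation s ->
  forall (X : cc_c0) (hX : 0 < len X) (Y : cc_c0) (f : Hom Y X),
    s X hX Y f = cc_s hX f.
Proof.
case=> s1 s2 _ X hX Y f.
case: cc_sP => /(_ X hX Y f) t1 /(_ X hX Y f) t2 _.
move: {s1 s2} (s1 X hX Y f) (s2 X hX Y f) t1 t2.
move: (s X hX Y f) (cc_s hX f) => {s}.
case: X hX f => [[|n] A0] // hX; case: A0 hX => B F hX.
case: Y => m A f h k h1 h2 k1 k2.
exact: (@section_unique (int A) (int B) F f h k h1 k1 h2 k2).
Qed.

Definition CCsys : CSystem := {| cs_c0 := cc_c0; cs_s := cc_s; cs_sP := cc_sP |}.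

End CCSystem.

(** * Functors of universe categories *)

Record UniverseFunctor (C C' : UniverseCategory) : Type := MkUniverseFunctor {
  uf_functor :> Functor C C';
  phi : Hom (uf_functor U) U;
  phit : Hom (uf_functor Ut) Ut;
  uf_canonical : forall (X : C) (F : Hom X U),
    is_pullback (fmap uf_functor (pr F)) (fmap uf_functor (Q F))
                (fmap uf_functor F) (fmap uf_functor univ);
  uf_pt : is_final (uf_functor pt);
  uf_square : is_pullback (fmap uf_functor univ) phit phi univ
}.

Arguments phi {_ _} _.
Arguments phit {_ _} _.

Section RecursiveDefinition.

Variables (C C' : UniverseCategory) (Phi : UniverseFunctor C C').

(* The second component of [H_{n+1}(A,F)], where [A'] and [psi] stand for
   [H_n(A)] and [psi_n(A)]. *)
Definition next_F (n : nat) (A : Obn C n) (A' : Obn C' n)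
    (psi : Iso (int A') (Phi (int A))) (F : Hom (int A) U) :
    Hom (int A') U :=
  psi ;; fmap Phi F ;; phi Phi.

(* The two equations that define [psi_{n+1}(A,F)]. *)
Definition next_psi_eqs (n : nat) (A : Obn C n) (A' : Obn C' n)
    (psi : Iso (int A') (Phi (int A))) (F : Hom (int A) U)
    (chi : Hom (int (ext (next_F psi F))) (Phi (int (ext F)))) : Prop :=
  chi ;; fmap Phi (pr F) = pr (next_F psi F) ;; psi /\
  chi ;; fmap Phi (Q F) ;; phit Phi = Q (next_F psi F).

(* Families that satisfy the recursive definition.  There is no clause for
   [n = 0]: [H 0] is a function between one-element sets and [psi 0 tt] an
   isomorphism [pt' -> Phi pt] to a final object.  In the clause for [n.+1] the
   equality of dependent pairs says that [H_{n+1}(A,F)] is the prescribed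
   object and that, with this source, [psi_{n+1}(A,F)] is [chi]. *)
Definition satisfies_recursion (H : forall n : nat, Obn C n -> Obn C' n)
    (psi : forall (n : nat) (A : Obn C n), Iso (int (H n A)) (Phi (int A))) :
    Prop :=
  forall (n : nat) (A : Obn C n) (F : Hom (int A) U),
  exists chi : Hom (int (ext (next_F (psi n A) F))) (Phi (int (ext F))),
    next_psi_eqs chi /\
    existT (fun B : Obn C' n.+1 => Hom (int B) (Phi (int (ext F))))
      (H n.+1 (ext F)) (psi n.+1 (ext F)) =
    existT (fun B : Obn C' n.+1 => Hom (int B) (Phi (int (ext F))))
      (ext (next_F (psi n A) F)) chi.

Definition H_ob (H : forall n : nat, Obn C n -> Obn C' n)
    (G : CCsys C) : CCsys C' :=
  existT (Obn C') (projT1 G) (H (projT1 G) (projT2 G)).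

(* The morphism [H(a)], for [a] from [G] to [D]. *)
Definition H_hom (H : forall n : nat, Obn C n -> Obn C' n)
    (psi : forall (n : nat) (A : Obn C n), Iso (int (H n A)) (Phi (int A)))
    (G D : CCsys C) (a : Hom G D) : Hom (H_ob H G) (H_ob H D) :=
  (psi (projT1 G) (projT2 G) : Hom _ _)
  ;; fmap Phi (a : Hom (int (projT2 G)) (int (projT2 D)))
  ;; iso_inv (psi (projT1 D) (projT2 D)).

End RecursiveDefinition.

Arguments satisfies_recursion {C C'} Phi H psi.
Arguments next_psi_eqs {C C'} Phi {n A A'} psi F chi.
Arguments H_hom {C C' Phi H} psi G D a.

(* Main.v *)
Require Import Defs.
From Stdlib Require Import ClassicalEpsilon ProofIrrelevance.
From mathcomp Require Import all_boot.

Set Implicit Arguments.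
Unset Strict Implicit.
Unset Printing Implicit Defensive.

(** Everything rests on one pull-back square.  Pasting the image under [Phi] of
    the canonical square of [F] with the square of [phit] and [phi] exhibits
    [Phi (X;F)], with the projections [Phi(p_{X,F})] and [Phi(Q(F)) ;; phit], as
    a pull-back of [Phi F ;; phi] and [p'] ([image_pullback]).  Transported along
    an isomorphism [psi : X' -> Phi X] it becomes a pull-back of
    [psi ;; Phi F ;; phi] and [p'], and so does the canonical square of
    this morphism in the target category.  Two pull-backs of the same pair of
    morphisms are isomorphic in exactly one way compatible with the projections:
    this is [psi_{n+1}(A,F)] ([next_psi_exists]).

    The map [a |-> psi ;; Phi a ;; theta^-1] preserves identities and
    composition ([transfer_id], [transfer_comp]).  The two equations that define
    [psi_{n+1}(A,F)] say how it acts on the projections of the canonical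
    squares: it takes [p_{X,F}] to the corresponding projection
    ([transfer_pr]), and the composite of [theta ;; Phi b ;; psi_{n+1}(A,F)^-1]
    with the other projection is [theta ;; Phi (b ;; Q(F)) ;; phit]
    ([transfer_Q]).  In the C-system of a universe category a morphism to
    [(B,F)] is determined by its composites with [p] and [Q], and both [q(f,Y)]
    and [s_f] are characterized by such composites, so these rules suffice for
    [H] to commute with [q] and [s]. *)

(** * Pull-back squares *)

Section Pullbacks.

Variable C : Category.

Lemma pullback_ext (P X Y Z : C) (p : Hom P X) (q : Hom P Y) (f : Hom X Z)
    (g : Hom Y Z) (W : C) (h k : Hom W P) :
  is_pullback p q f g -> h ;; p = k ;; p -> h ;; q = k ;; q -> h = k.
Proof.
case=> sq lift ep eq.
case: (lift W (h ;; p) (h ;; q)); first by rewrite !comp_assoc sq.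
by move=> x [_ ux]; rewrite -(ux h) // -(ux k).
Qed.

Lemma pullback_paste (P X Y Z Y' Z' : C) (p : Hom P X) (q : Hom P Y)
    (f : Hom X Z) (g : Hom Y Z) (q' : Hom Y Y') (f' : Hom Z Z')
    (g' : Hom Y' Z') :
  is_pullback p q f g -> is_pullback g q' f' g' ->
  is_pullback p (q ;; q') (f ;; f') g'.
Proof.
move=> pb1 pb2; split.
  by rewrite -comp_assoc (proj1 pb1) !comp_assoc (proj1 pb2).
move=> W u v euv.
have [|y [[yg yq'] _]] := proj2 pb2 W (u ;; f) v; first by rewrite comp_assoc.
have [//|h [[hp hq] _]] := proj2 pb1 W u y.
exists h; split=> [|k [kp kq]].
  by rewrite -comp_assoc hq.
apply: (pullback_ext pb1); first by rewrite hp kp.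
apply: (pullback_ext pb2).
  by rewrite !comp_assoc -(proj1 pb1) -!comp_assoc hp kp.
by rewrite hq yq' comp_assoc kq.
Qed.

Lemma pullback_iso (P X X' Y Z : C) (p : Hom P X) (q : Hom P Y)
    (f : Hom X Z) (g : Hom Y Z) (psi : Iso X' X) :
  is_pullback p q f g -> is_pullback (p ;; iso_inv psi) q (psi ;; f) g.
Proof.
move=> pbP; split.
  by rewrite comp_assoc -(comp_assoc (iso_inv _)) iso_inv_mor comp_id_l (proj1 pbP).
move=> W u v euv.
have [|h [[hp hq] _]] := proj2 pbP W (u ;; psi) v; first by rewrite comp_assoc.
exists h; split=> [|k [kp kq]].
  by rewrite -comp_assoc hp comp_assoc iso_mor_inv comp_id_r.
apply: (pullback_ext pbP); last by rewrite hq kq.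
by rewrite hp -kp !comp_assoc iso_inv_mor comp_id_r.
Qed.

Lemma pullback_compare (P P' X Y Z : C) (p : Hom P X) (q : Hom P Y)
    (p' : Hom P' X) (q' : Hom P' Y) (f : Hom X Z) (g : Hom Y Z) :
  is_pullback p q f g -> is_pullback p' q' f g ->
  exists chi : Iso P P', chi ;; p' = p /\ chi ;; q' = q.
Proof.
move=> pbP pbP'.
have [h [[hp hq] _]] := proj2 pbP' P p q (proj1 pbP).
have [k [[kp kq] _]] := proj2 pbP P' p' q' (proj1 pbP').
have hk : h ;; k = idm P.
  by apply: (pullback_ext pbP); rewrite comp_id_l comp_assoc ?kp ?kq.
have kh : k ;; h = idm P'.
  by apply: (pullback_ext pbP'); rewrite comp_id_l comp_assoc ?hp ?hq.
by exists (MkIso hk kh).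
Qed.

Lemma iso_ext (X Y : C) (psi theta : Iso X Y) :
  psi = theta :> Hom X Y -> psi = theta.
Proof.
case: psi theta => [f g fg gf] [f' g' fg' gf'] /= e; subst f'.
have eg : g = g' by rewrite -(comp_id_l g') -gf comp_assoc fg' comp_id_r.
subst g'; congr MkIso; exact: proof_irrelevance.
Qed.

Lemma final_iso (S T : C) : is_final S -> is_final T ->
  exists psi : Iso S T, forall f : Hom S T, f = psi.
Proof.
move=> finS finT; case: (finT S) => h uh; case: (finS T) => k _.
have hk : h ;; k = idm S by case: (finS S) => x ux; rewrite (ux (idm S)).
have kh : k ;; h = idm T by case: (finT T) => x ux; rewrite (ux (idm T)).
by exists (MkIso hk kh).
Qed.

End Pullbacks.

Section UniverseFunctor.

Variables (C C' : UniverseCategory) (Phi : UniverseFunctor C C').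

(** * The recursion *)

Lemma image_pullback (X : C) (F : Hom X U) :
  is_pullback (fmap Phi (pr F)) (fmap Phi (Q F) ;; phit Phi)
              (fmap Phi F ;; phi Phi) univ.
Proof. exact: pullback_paste (uf_canonical Phi F) (uf_square Phi). Qed.

Lemma next_psi_exists (n : nat) (A : Obn C n) (A' : Obn C' n)
    (psi : Iso (int A') (Phi (int A))) (F : Hom (int A) U) :
  exists chi : Iso (int (ext (next_F psi F))) (Phi (int (ext F))),
    next_psi_eqs Phi psi F chi.
Proof.
have pbE := pullback_iso psi (image_pullback F).
rewrite -comp_assoc in pbE.
case: (pullback_compare (pb_pullback (next_F psi F)) pbE) => chi [e1 e2].
exists chi; split; last by rewrite comp_assoc.
by rewrite -e1 !comp_assoc iso_inv_mor comp_id_r.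
Qed.

Lemma next_psi_ext (n : nat) (A : Obn C n) (A' : Obn C' n)
    (psi : Iso (int A') (Phi (int A))) (F : Hom (int A) U)
    (chi chi' : Hom (int (ext (next_F psi F))) (Phi (int (ext F)))) :
  next_psi_eqs Phi psi F chi -> next_psi_eqs Phi psi F chi' -> chi = chi'.
Proof.
move=> [p1 q1] [p2 q2]; apply: (pullback_ext (image_pullback F)).
  by rewrite p1 p2.
by rewrite -!comp_assoc q1 q2.
Qed.

(** The source of [psi_{n+1}(A,F)] depends on [psi_n(A)], so two families are
    compared as dependent pairs.  An inverse is determined by its
    morphism, so the equality is one of underlying morphisms. *)
Lemma next_psi_unique (n : nat) (A : Obn C n) (F : Hom (int A) U)
    (A1 A2 : Obn C' n) (psi1 : Iso (int A1) (Phi (int A)))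
    (psi2 : Iso (int A2) (Phi (int A)))
    (chi1 : Hom (int (ext (next_F psi1 F))) (Phi (int (ext F))))
    (chi2 : Hom (int (ext (next_F psi2 F))) (Phi (int (ext F)))) :
  existT (fun B : Obn C' n => Hom (int B) (Phi (int A))) A1 psi1 =
  existT (fun B : Obn C' n => Hom (int B) (Phi (int A))) A2 psi2 ->
  next_psi_eqs Phi psi1 F chi1 -> next_psi_eqs Phi psi2 F chi2 ->
  existT (fun B : Obn C' n.+1 => Hom (int B) (Phi (int (ext F))))
    (ext (next_F psi1 F)) chi1 =
  existT (fun B : Obn C' n.+1 => Hom (int B) (Phi (int (ext F))))
    (ext (next_F psi2 F)) chi2.
Proof.
move=> e; have eA : A1 = A2 := projT1_eq e; subst A2.
have epsi : psi1 = psi2 by apply: iso_ext; exact: EqdepTheory.inj_pair2 e.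
by subst psi2 => eq1 eq2; rewrite (next_psi_ext eq1 eq2).
Qed.

Lemma psi0_exists : exists psi : @Iso C' pt (Phi pt),
  forall f : @Hom C' pt (Phi pt), f = psi.
Proof. exact: final_iso (pt_final (u := C')) (uf_pt Phi). Qed.

Definition psi0 : @Iso C' pt (Phi pt) :=
  proj1_sig (constructive_indefinite_description _ psi0_exists).

Lemma psi0_unique (f : @Hom C' pt (Phi pt)) : f = psi0.
Proof. by rewrite /psi0; case: constructive_indefinite_description. Qed.

Definition next_psi (n : nat) (A : Obn C n) (A' : Obn C' n)
    (psi : Iso (int A') (Phi (int A))) (F : Hom (int A) U) :
    Iso (int (ext (next_F psi F))) (Phi (int (ext F))) :=
  proj1_sig (constructive_indefinite_description _ (next_psi_exists psi F)).

Lemma next_psiP (n : nat) (A : Obn C n) (A' : Obn C' n)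
    (psi : Iso (int A') (Phi (int A))) (F : Hom (int A) U) :
  next_psi_eqs Phi psi F (next_psi psi F).
Proof. by rewrite /next_psi; case: constructive_indefinite_description. Qed.

(** [H_{n+1}] depends on [psi_n], so the two families are built together.  The
    clause for [n.+1] holds by computation, so that [H] of an extension is an
    extension without transport along an equality of objects. *)
Fixpoint H_psi (n : nat) :
    {H : Obn C n -> Obn C' n & forall A, Iso (int (H A)) (Phi (int A))} :=
  match n with
  | 0 => existT (fun H : Obn C 0 -> Obn C' 0 =>
                   forall A, Iso (int (H A)) (Phi (int A)))
           (fun=> tt) (fun=> psi0)
  | m.+1 => existT (fun H : Obn C m.+1 -> Obn C' m.+1 =>
                      forall A, Iso (int (H A)) (Phi (int A)))
      (fun AF => ext (next_F (projT2 (H_psi m) (projT1 AF)) (projT2 AF)))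
      (fun AF => next_psi (projT2 (H_psi m) (projT1 AF)) (projT2 AF))
  end.

Definition Hn (n : nat) : Obn C n -> Obn C' n := projT1 (H_psi n).

Definition psin (n : nat) (A : Obn C n) : Iso (int (Hn A)) (Phi (int A)) :=
  projT2 (H_psi n) A.

Lemma psinP : satisfies_recursion Phi Hn psin.
Proof.
move=> n A F; exists (next_psi (psin A) F); split=> //; exact: next_psiP.
Qed.

Lemma recursion_unique (K : forall n : nat, Obn C n -> Obn C' n)
    (theta : forall (n : nat) (A : Obn C n), Iso (int (K n A)) (Phi (int A))) :
  satisfies_recursion Phi K theta ->
  forall (n : nat) (A : Obn C n),
    existT (fun B : Obn C' n => Hom (int B) (Phi (int A))) (K n A) (theta n A) =
    existT (fun B : Obn C' n => Hom (int B) (Phi (int A))) (Hn A) (psin A).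
Proof.
move=> Krec; elim=> [|n IHn].
  case; move: (K 0 tt) (theta 0 tt) => [] chi.
  by congr existT; exact: psi0_unique.
case=> A F; have [chi [chiP ->]] := Krec n A F.
exact: (next_psi_unique (IHn A) chiP (next_psiP (psin A) F)).
Qed.

(** * The action on morphisms *)

(** The morphism [H(a)], with the isomorphisms at source and target left
    arbitrary, so that the rules below do not depend on the recursion. *)
Definition transfer (X Y : C) (X' Y' : C') (psi : Iso X' (Phi X))
    (theta : Iso Y' (Phi Y)) (a : Hom X Y) : Hom X' Y' :=
  psi ;; fmap Phi a ;; iso_inv theta.

Lemma transfer_id (X : C) (X' : C') (psi : Iso X' (Phi X)) :
  transfer psi psi (idm X) = idm X'.
Proof.
by rewrite /transfer (functor_id (functorP Phi)) comp_id_r iso_mor_inv.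
Qed.

Lemma transfer_comp (X Y Z : C) (X' Y' Z' : C') (psi : Iso X' (Phi X))
    (theta : Iso Y' (Phi Y)) (zeta : Iso Z' (Phi Z))
    (a : Hom X Y) (b : Hom Y Z) :
  transfer psi zeta (a ;; b) = transfer psi theta a ;; transfer theta zeta b.
Proof.
rewrite /transfer (functor_comp (functorP Phi)) !comp_assoc.
by rewrite -(comp_assoc (iso_inv theta)) iso_inv_mor comp_id_l.
Qed.

Section Extension.

Variables (n : nat) (B : Obn C n) (B' : Obn C' n).
Variables (psi : Iso (int B') (Phi (int B))) (F : Hom (int B) U).

Lemma transfer_pr : transfer (next_psi psi F) psi (pr F) = pr (next_F psi F).
Proof.
rewrite /transfer (proj1 (next_psiP psi F)).
by rewrite comp_assoc iso_mor_inv comp_id_r.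
Qed.

(** [Q(F)] cannot be conjugated, as [phit : Phi Ut -> Ut'] may fail to be
    invertible; hence a rule for composites with [Q] on the right. *)
Lemma transfer_Q (X : C) (X' : C') (theta : Iso X' (Phi X)) (b : Hom X (pb F)) :
  transfer theta (next_psi psi F) b ;; Q (next_F psi F) =
  theta ;; fmap Phi (b ;; Q F) ;; phit Phi.
Proof.
rewrite -(proj2 (next_psiP psi F)) /transfer (functor_comp (functorP Phi)).
rewrite !comp_assoc -(comp_assoc (iso_inv (next_psi psi F))).
by rewrite iso_inv_mor comp_id_l.
Qed.

(** On objects this says that [H] commutes with the operation [f^*]. *)
Lemma next_F_transfer (m : nat) (A : Obn C m) (A' : Obn C' m)
    (theta : Iso (int A') (Phi (int A))) (f : Hom (int A) (int B)) :
  next_F theta (f ;; F) = transfer theta psi f ;; next_F psi F.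
Proof.
rewrite /next_F /transfer (functor_comp (functorP Phi)) !comp_assoc.
by rewrite -(comp_assoc (iso_inv psi)) iso_inv_mor comp_id_l.
Qed.

End Extension.

(** * The homomorphism of C-systems *)

(** Transparent, so that on an object of positive length the transport along
    this equality in the clause for [q] computes away. *)
Lemma H_ob_ft (X : CCsys C) : H_ob Hn (ft X) = ft (H_ob Hn X).
Proof. by case: X => [[|n] A]. Defined.

Lemma H_functor : is_functor (H_hom psin).
Proof.
split=> [X|X Y Z f g]; first exact: (transfer_id (psin (projT2 X))).
exact: (transfer_comp (psin (projT2 X)) (psin (projT2 Y)) (psin (projT2 Z)) f g).
Qed.

Lemma H_p (X : CCsys C) :
  mor (H_hom psin X (ft X) (c0_p X)) = mor (c0_p (H_ob Hn X)).
Proof.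
case: X => [[|n] A]; congr mor.
  by case: A; exact: (transfer_id psi0).
by case: A => B F; exact: transfer_pr.
Qed.

(** For [Y = (B,F)] and [H(Y) = (B',F')], both sides lie over [H(f)], and their
    composites with [Q(F')] are the [Q] of their sources; their sources agree only up to
    [next_F_transfer]. *)
Lemma H_q (Y : CCsys C) (hY : 0 < len Y) (hHY : 0 < len (H_ob Hn Y))
    (X : CCsys C) (f : Hom X (ft Y)) :
  mor (H_hom psin (star Y hY f) Y (c0_q Y hY f)) =
  mor (c0_q (H_ob Hn Y) hHY (recod (H_ob_ft Y) (H_hom psin X (ft Y) f))).
Proof.
case: Y hY hHY f => [[|n] A0] // hY hHY; case: A0 hY hHY => B F hY hHY.
case: X => m A f; move: (f : Hom (int A) (int B)) => {}f.
have sqP : transfer (next_psi (psin A) (f ;; F)) (next_psi (psin B) F) (Q2 f F)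
             ;; pr (next_F (psin B) F) =
           pr (next_F (psin A) (f ;; F)) ;; transfer (psin A) (psin B) f.
  by rewrite -2!transfer_pr -!transfer_comp Q2_pr.
have sqQ : transfer (next_psi (psin A) (f ;; F)) (next_psi (psin B) F) (Q2 f F)
             ;; Q (next_F (psin B) F) = Q (next_F (psin A) (f ;; F)).
  by rewrite transfer_Q Q2_Q; exact: (proj2 (next_psiP (psin A) (f ;; F))).
apply: (cc_mor_eq2 (next_F_transfer (psin B) F (psin A) f) sqP _ sqQ).
- exact: Q2_pr.
- exact: Q2_Q.
Qed.

(** The composite of either side with [p] is the identity, and with [Q] it is
    the composite of [H(f)] with [Q]. *)
Lemma H_s (Y : CCsys C) (hY : 0 < len Y) (hHY : 0 < len (H_ob Hn Y))
    (X : CCsys C) (f : Hom X Y) :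
  mor (H_hom psin X (star Y hY (f ;; c0_p Y)) (cs_s Y hY f)) =
  mor (cs_s (H_ob Hn Y) hHY (H_hom psin X Y f)).
Proof.
case: Y hY hHY f => [[|n] A0] // hY hHY; case: A0 hY hHY => B F hY hHY.
case: X => m A f; move: (f : Hom (int A) (pb F)) => {}f.
have eF : next_F (psin A) ((f ;; pr F) ;; F) =
    (transfer (psin A) (next_psi (psin B) F) f ;; pr (next_F (psin B) F))
      ;; next_F (psin B) F.
  by rewrite (next_F_transfer (psin B)) -transfer_pr -transfer_comp.
apply: (@cc_mor_eq C' (cc_mk (Hn A)) _ _ _ _
  (transfer (psin A) (next_psi (psin A) ((f ;; pr F) ;; F)) (pair (s_comm f)))
  (pair (@s_comm C' _ _ (next_F (psin B) F)
     (transfer (psin A) (next_psi (psin B) F) f))) eF).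
- by rewrite pair_pr -transfer_pr -transfer_comp pair_pr transfer_id.
- by rewrite pair_Q !transfer_Q pair_Q.
Qed.

Lemma H_CSystem_hom : is_CSystem_hom (H_hom psin).
Proof.
exact: (@MkIsCSystemHom (CCsys C) (CCsys C') (H_ob Hn) _ H_functor
  (fun=> erefl) H_ob_ft H_p (fun Y hY => H_q hY _) (fun Y hY => H_s hY _)).
Qed.

End UniverseFunctor.

Theorem mainTheorem2 (C C' : UniverseCategory) (Phi : UniverseFunctor C C') :
  (* stage 0 *)
  (exists psi0 : @Iso C' pt (Phi pt),
     forall chi : @Iso C' pt (Phi pt), iso_mor chi = iso_mor psi0) /\
  (* stage n+1 *)
  (forall (n : nat) (A : Obn C n) (A' : Obn C' n)
      (psi : Iso (int A') (Phi (int A))) (F : Hom (int A) U),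
     exists chi : Iso (int (ext (next_F psi F))) (Phi (int (ext F))),
       next_psi_eqs Phi psi F chi /\
       (forall chi' : Hom (int (ext (next_F psi F))) (Phi (int (ext F))),
          next_psi_eqs Phi psi F chi' -> chi' = chi)) /\
  (* hence there is exactly one family (H, psi), and it yields H(Phi,phi,phit) *)
  (exists (H : forall n : nat, Obn C n -> Obn C' n)
      (psi : forall (n : nat) (A : Obn C n), Iso (int (H n A)) (Phi (int A))),
     satisfies_recursion Phi H psi /\
     (forall (K : forall n : nat, Obn C n -> Obn C' n)
        (theta : forall (n : nat) (A : Obn C n),
           Iso (int (K n A)) (Phi (int A))),
        satisfies_recursion Phi K theta ->
        forall (n : nat) (A : Obn C n),
          existT (fun B : Obn C' n => Hom (int B) (Phi (int A)))
            (K n A) (theta n A) =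
          existT (fun B : Obn C' n => Hom (int B) (Phi (int A)))
            (H n A) (psi n A)) /\
     is_CSystem_hom (H_hom psi)).
Proof.
split; [|split].
- by exists (psi0 Phi) => chi; exact: psi0_unique.
- move=> n A A' psi F; exists (next_psi psi F); split; first exact: next_psiP.
  by move=> chi /next_psi_ext; apply; exact: next_psiP.
- exists (@Hn C C' Phi), (@psin C C' Phi).
  split; [exact: psinP | split; [exact: recursion_unique|]].
  exact: H_CSystem_hom.
Qed.
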